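(* Let $F_{\{a,b\}}$ be the free group with two generators $a,b$, let $\varepsilon$ be its identity element, let $C=\{a,a^{-1},b,b^{-1},\varepsilon\}$, and let $\le$ be any total order making $F_{\{a,b\}}$ a totally ordered group; let $\le^{-1}$ be the inverse order. Let $W_1\subseteq C^\omega$ (resp. $W_2\subseteq C^\omega$) be the energy condition over $(F_{\{a,b\}},\le)$ (resp. over $(F_{\{a,b\}},\le^{-1})$) defined by the valuation of colors which maps each element of $C$ to the corresponding element of $F_{\{a,b\}}$. Then: (1) $W_1\cup W_2$ is positional for Alice in all arenas without nodes of Bob: for every arena over $C$ with $V_B=\varnothing$ there is a positional strategy $\sigma$ of Alice such that for every node $s$, if $\sigma$ is not winning w.r.t. $W_1\cup W_2$ from $s$, then Bob has a winning strategy w.r.t. $W_1\cup W_2$ from $s$ (that is, no play from $s$ has its sequence of colors in $W_1\cup W_2$); (2) $W_1\cup W_2$ is not half-positional.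
   Context: For a set $C$, $C^*$, $C^\omega$ denote the sets of finite and infinite words over $C$. Elements of $C=\{a,a^{-1},b,b^{-1},\varepsilon\}$ are treated as letters, so there is no cancellation in words over $C$. **Energy conditions.** A totally ordered group is a triple $(G,+,\le)$ where $(G,+)$ is a (not necessarily abelian) group and $\le$ is a total order on $G$ such that $a\le b$ implies $x+a+y\le x+b+y$ for all $a,b,x,y\in G$ (for the free group, the operation is written multiplicatively). A valuation of colors is a function $\mathrm{val}\colon C\to G$, extended to $C^*$ by $\mathrm{val}(\text{empty word})=0$, $\mathrm{val}(c_1\ldots c_n)=\mathrm{val}(c_1)+\ldots+\mathrm{val}(c_n)$. The energy condition over $(G,+,\le)$ defined by $\mathrm{val}$ is the set of all $c_1c_2c_3\ldots\in C^\omega$ such that the sequence $\{\mathrm{val}(c_1\ldots c_n)\}_{n=1}^\infty$ has an infinite (strictly) decreasing subsequence w.r.t. $\le$. It is known that free groups admit total orders making them totally ordered groups. **Arenas and games.** An arena over a non-empty finite set (of colors) $C$ is a tuple $\langle V_A,V_B,E\rangle$ where $V_A,V_B$ are disjoint finite sets and $E\subseteq (V_A\cup V_B)\times C\times (V_A\cup V_B)$ is such that every $s\in V_A\cup V_B$ has some $(s,c,t)\in E$. Nodes in $V_A$ are Alice's, nodes in $V_B$ are Bob's. For an edge $e=(s,c,t)$, put $\mathrm{source}(e)=s$, $\mathrm{col}(e)=c$, $\mathrm{target}(e)=t$. The infinite-duration game from a node $s$: starting at $s$, at each turn the owner of the current node chooses an edge whose source is the current node, and the play moves to the target of this edge. This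 gives an infinite path $e_1,e_2,e_3,\ldots$ (a play). A strategy of a player selects an edge at each of that player's turns depending on the path so far. A winning condition is a set $W\subseteq C^\omega$. A strategy of Alice is winning from $s$ w.r.t. $W$ if every play from $s$ consistent with it satisfies $\mathrm{col}(e_1)\mathrm{col}(e_2)\mathrm{col}(e_3)\ldots\in W$; a strategy of Bob is winning from $s$ w.r.t. $W$ if every play from $s$ consistent with it satisfies $\mathrm{col}(e_1)\mathrm{col}(e_2)\ldots\notin W$. A positional strategy of Alice is a function $\sigma\colon V_A\to E$ with $\mathrm{source}(\sigma(u))=u$ for all $u\in V_A$ (whenever at $u$, Alice chooses $\sigma(u)$). $W$ is half-positional if for every (finite) arena over $C$ there is a positional strategy $\sigma$ of Alice such that for every node $s$: if $\sigma$ is not winning w.r.t. $W$ from $s$, then Bob has a winning strategy w.r.t. $W$ from $s$. *)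

(* Defs.v *)
From HB Require Import structures.
From mathcomp Require Import all_boot.
From mathcomp Require Import classical_sets.

Set Implicit Arguments.
Unset Strict Implicit.
Unset Printing Implicit Defensive.

Local Open Scope group_scope.
Local Open Scope classical_set_scope.

(** * The free group on [X], realized as the reduced words over [X] and its
    formal inverses: the letter [(x, true)] is x, [(x, false)] is x^-1. *)

Section FreeGroup.
Variable X : choiceType.

Notation letter := (X * bool)%type.

Definition inv_letter (l : letter) : letter := (l.1, ~~ l.2).

Definition reduced : pred (seq letter) :=
  sorted (fun l m => m != inv_letter l).

Record free_group : Type := FreeGroup {
  fg_word :> seq letter;
  fg_reduced : reduced fg_word }.

HB.instance Definition _ := [isSub for fg_word].
HB.instance Definition _ := [Choice of free_group by <:].

Definition push_letter (l : letter) (w : seq letter) : seq letter :=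
  if w is m :: w' then if m == inv_letter l then w' else l :: w else [:: l].

Definition mul_word (u v : seq letter) : seq letter := foldr push_letter v u.

Definition inv_word (u : seq letter) : seq letter := rev (map inv_letter u).

Lemma inv_letterK : involutive inv_letter.
Proof. by case=> x s; rewrite /inv_letter /= negbK. Qed.

Lemma push_reduced l w : reduced w -> reduced (push_letter l w).
Proof.
case: w => [|m w] //= wr; case: ifPn => [_|ml] /=.
  by case: w wr => //= n w /andP[].
by rewrite ml.
Qed.

Lemma mul_reduced u v : reduced v -> reduced (mul_word u v).
Proof. by move=> vr; elim: u => //= l u; apply: push_reduced. Qed.

Lemma pushK l w : reduced w -> push_letter (inv_letter l) (push_letter l w) = w.
Proof.
case: w => [|m w] /= wr; first by rewrite inv_letterK eqxx.
case: eqP => [ml|_] /=; last by rewrite inv_letterK eqxx.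
case: w wr => [|n w] /=; first by rewrite ml.
by rewrite ml => /andP[/negPf-> _].
Qed.

Lemma mul_push l u v : reduced v ->
  mul_word (push_letter l u) v = push_letter l (mul_word u v).
Proof.
move=> vr; case: u => [|m u] //=; case: eqP => //= ->.
by rewrite -{1}(inv_letterK l) pushK // mul_reduced.
Qed.

Lemma mul_wordA u v w : reduced w ->
  mul_word u (mul_word v w) = mul_word (mul_word u v) w.
Proof. by move=> wr; elim: u => //= l u ->; rewrite mul_push. Qed.

Lemma mul_word_nil u : reduced u -> mul_word u [::] = u.
Proof.
elim: u => //= l u IHu ur.
rewrite IHu; last by case: u ur {IHu} => //= m u /andP[].
by case: u ur {IHu} => //= m u /andP[/negPf->].
Qed.

Lemma inv_reduced u : reduced u -> reduced (inv_word u).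
Proof.
move=> ur; rewrite /reduced /inv_word rev_sorted sorted_map.
apply: sub_sorted ur => l m /=; apply: contraNneq => ->.
by rewrite inv_letterK.
Qed.

Lemma mul_word_cat u v w : mul_word (u ++ v) w = mul_word u (mul_word v w).
Proof. exact: foldr_cat. Qed.

Lemma mul_invw u w : reduced w -> mul_word (inv_word u) (mul_word u w) = w.
Proof.
elim: u w => //= l u IHu w wr.
rewrite /inv_word /= rev_cons -cats1 mul_word_cat /= pushK ?mul_reduced //.
exact: IHu.
Qed.

Lemma inv_wordK : involutive inv_word.
Proof.
move=> u; rewrite /inv_word map_rev revK -map_comp map_id_in // => l _ /=.
exact: inv_letterK.
Qed.

Definition fg_one : free_group := @FreeGroup [::] isT.
Definition fg_inv (u : free_group) : free_group :=
  FreeGroup (inv_reduced (fg_reduced u)).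
Definition fg_mul (u v : free_group) : free_group :=
  FreeGroup (mul_reduced u (fg_reduced v)).

Lemma fg_mulA : associative fg_mul.
Proof. by move=> u v w; apply/val_inj/mul_wordA/fg_reduced. Qed.

Lemma fg_mul1 : left_id fg_one fg_mul.
Proof. by move=> u; apply/val_inj. Qed.

Lemma fg_mulr1 : right_id fg_one fg_mul.
Proof. by move=> u; apply/val_inj/mul_word_nil/fg_reduced. Qed.

Lemma fg_mulV : left_inverse fg_one fg_inv fg_mul.
Proof.
move=> u; apply: val_inj => /=.
by rewrite -{2}(mul_word_nil (fg_reduced u)) mul_invw.
Qed.

Lemma fg_mulrV : right_inverse fg_one fg_inv fg_mul.
Proof.
move=> u; have -> : u = fg_inv (fg_inv u) by apply/val_inj/esym/inv_wordK.
rewrite [X in fg_mul _ X](_ : _ = fg_inv u) ?fg_mulV //.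
by apply/val_inj; rewrite /= inv_wordK.
Qed.

HB.instance Definition _ := isGroup.Build free_group
  fg_mulA fg_mul1 fg_mulr1 fg_mulV fg_mulrV.

Definition fg_gen (x : X) : free_group := @FreeGroup [:: (x, true)] isT.

Lemma fg_gen_decomp (u : free_group) :
  u = \prod_(l <- fg_word u) (if l.2 then fg_gen l.1 else (fg_gen l.1)^-1).
Proof.
apply: val_inj; case: u => w /= wr.
elim: w wr => [|l w IHw] lwr; first by rewrite big_nil.
have wr : reduced w by case: w lwr {IHw} => //= m w /andP[].
rewrite big_cons -[LHS](mul_word_nil lwr) /= (mul_word_nil wr) {1}(IHw wr).
by case: l {lwr} => x [].
Qed.

Lemma fg_universal (G : groupType) (f : X -> G) :
  exists2 h : free_group -> G, monoid_morphism h /\ (forall x, h (fg_gen x) = f x)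
    & forall h' : free_group -> G,
        monoid_morphism h' -> (forall x, h' (fg_gen x) = f x) -> h' =1 h.
Proof.
pose g (l : letter) := if l.2 then f l.1 else (f l.1)^-1.
have gV l : g (inv_letter l) = (g l)^-1.
  by case: l => x []; rewrite /g /= ?invgK.
pose h (u : seq letter) := \prod_(l <- u) g l.
have hpush l w : h (push_letter l w) = g l * h w.
  rewrite /h; case: w => [|m w] /=; first by rewrite big_seq1 big_nil mulg1.
  by case: eqP => [->|_]; rewrite !big_cons // gV mulgA mulgV mul1g.
exists (fun u : free_group => h u).
  split; last by move=> x; rewrite /h big_seq1.
  split=> [|u v /=]; first by rewrite /h big_nil.
  rewrite /mul_word; elim: (fg_word u) => [|l w IHw] /=.
    by rewrite {2}/h big_nil mul1g.
  by rewrite hpush IHw mulgA /h big_cons.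
move=> h' [h'1 h'M] h'f u.
have h'V v : h' v^-1 = (h' v)^-1.
  by apply: (mulIg (h' v)); rewrite -h'M !mulVg.
rewrite [in LHS](fg_gen_decomp u) (big_morph h' h'M h'1); apply: eq_bigr => l _.
by rewrite /g; case: ifP => _; rewrite ?h'V h'f.
Qed.

End FreeGroup.

(** * Energy conditions *)

Definition totally_ordered_group (G : groupType) (le : rel G) : Prop :=
  [/\ reflexive le, antisymmetric le, transitive le, total le
    & forall a b x y : G, le a b -> le (x * a * y) (x * b * y)].

Definition word_val (C : Type) (G : groupType) (val : C -> G) (w : seq C) : G :=
  \prod_(c <- w) val c.

(* The letters of an infinite word are numbered from 0, so that
   [mkseq w (k i).+1] is the prefix c_1 ... c_n with n = k i + 1 >= 1. *)
Definition energy_condition (C : Type) (G : groupType) (le : rel G)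
    (val : C -> G) : set (nat -> C) :=
  [set w | exists2 k : nat -> nat, {homo k : i j / i < j}%N &
     forall i j, (i < j)%N ->
       let x := word_val val (mkseq w (k i).+1) in
       let y := word_val val (mkseq w (k j).+1) in
       le y x && (y != x)].

(** * Arenas and games *)

Record arena (C : finType) : Type := Arena {
  alice_node : finType;
  bob_node : finType;
  edges : {set (alice_node + bob_node) * C * (alice_node + bob_node)};
  edges_total : forall s, exists c t, (s, c, t) \in edges }.

Inductive player := Alice | Bob.

Section Games.
Variables (C : finType) (A : arena C).

Definition node : finType := (alice_node A + bob_node A)%type.

Definition edge : Type := {e : node * C * node | e \in edges A}.

Definition source (e : edge) : node := (sval e).1.1.
Definition col (e : edge) : C := (sval e).1.2.
Definition target (e : edge) : node := (sval e).2.

Definition is_play (s : node) (e : nat -> edge) : Prop :=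
  source (e 0) = s /\ forall n, target (e n) = source (e n.+1).

Definition owned (p : player) : finType :=
  match p with Alice => alice_node A | Bob => bob_node A end.

Definition owned_node (p : player) : owned p -> node :=
  match p with Alice => inl | Bob => inr end.

(* [st h u] is the edge chosen at the current node [u] after the path [h];
   passing [u] is needed to determine the position when [h] is empty. *)
Definition strategy (p : player) : Type := seq edge -> owned p -> edge.

Definition is_strategy (p : player) (st : strategy p) : Prop :=
  forall h u, source (st h u) = owned_node u.

Definition consistent (p : player) (st : strategy p) (e : nat -> edge) : Prop :=
  forall n u, source (e n) = owned_node u -> e n = st (mkseq e n) u.

Definition winning (W : set (nat -> C)) (p : player) (st : strategy p)
    (s : node) : Prop :=
  forall e, is_play s e -> consistent st e ->
    match p with
    | Alice => W (fun n => col (e n))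
    | Bob => ~ W (fun n => col (e n))
    end.

Definition is_positional (sigma : alice_node A -> edge) : Prop :=
  forall u, source (sigma u) = inl u.

Definition positional_strategy (sigma : alice_node A -> edge) : strategy Alice :=
  fun _ u => sigma u.

Definition alice_positional (W : set (nat -> C)) : Prop :=
  exists2 sigma : alice_node A -> edge, is_positional sigma &
    forall s : node, ~ winning W (positional_strategy sigma) s ->
      exists2 tau : strategy Bob, is_strategy tau & winning W tau s.

End Games.

Definition half_positional (C : finType) (W : set (nat -> C)) : Prop :=
  forall A : arena C, alice_positional A W.

(** * Colors *)

Definition F2 : groupType := free_group bool.

Definition gen_a : F2 := fg_gen true.
Definition gen_b : F2 := fg_gen false.

Definition color : finType :=
  seq_sub [:: gen_a; gen_a^-1; gen_b; gen_b^-1; (1 : F2)].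

Definition color_val (c : color) : F2 := ssval c.

(* Main.v *)
Require Import Defs.
From mathcomp Require Import all_boot.
From mathcomp Require Import boolp classical_sets.

(** By the monotone subsequence theorem, a color word lies in the union of the
    two energy conditions exactly when its prefixes take infinitely many values
    in the free group ([energy_unionP]).  The order also shows that the free
    group is torsion-free ([tog_torsion_free]).

    When Bob has no nodes, the game is about a finite graph with edges labelled
    by a torsion-free group.  A run of a positional strategy is eventually
    periodic, and its values are finitely many exactly when its cycle has value
    1.  If this holds for all positional runs from [s], then every path from
    [s] only meets values met by positional runs ([positional_suffices]).
    As the condition ignores finite prefixes, positional strategies good for
    different starting nodes can be glued ([uniform_positional]).

    For the second part, let Alice repeatedly choose one of the two generators,
    after which Bob chooses that generator or its inverse.  By alternating
    between the two generators Alice produces reduced words of growing length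
    ([alternating_play]), whereas against a positional choice Bob can
    cancel every second letter ([constant_play]). *)

Set Implicit Arguments.
Unset Strict Implicit.
Unset Printing Implicit Defensive.

Local Open Scope classical_set_scope.

(** * Words of finitely many prefix values *)

Section FinitelyValued.
Variables (C : Type) (G : groupType) (val : C -> G).
Implicit Types (w : nat -> C) (g : G).
Local Open Scope group_scope.

Definition finitely_valued w : Prop :=
  exists L : seq G, forall n, word_val val (mkseq w n) \in L.

Lemma word_val_mkseqD w m n :
  word_val val (mkseq w (m + n)) =
  word_val val (mkseq w m) * word_val val (mkseq (fun i => w (m + i)%N) n).
Proof.
rewrite /word_val -big_cat; congr (\prod_(c <- _) _).
by rewrite /mkseq iotaD map_cat add0n -[X in iota X n]addn0 iotaDl -map_comp.
Qed.

Lemma word_val_mkseqS w n :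
  word_val val (mkseq w n.+1) = word_val val (mkseq w n) * val (w n).
Proof. by rewrite -addn1 word_val_mkseqD /word_val big_seq1 addn0. Qed.

Lemma finitely_valued_shift w m :
  finitely_valued (fun i => w (m + i)%N) <-> finitely_valued w.
Proof.
pose g := word_val val (mkseq w m).
split=> -[L wL]; last first.
  exists [seq g^-1 * x | x <- L] => n.
  by apply/mapP; exists (word_val val (mkseq w (m + n))); rewrite ?wL //
    word_val_mkseqD mulKg.
exists ([seq g * x | x <- L] ++ mkseq (fun n => word_val val (mkseq w n)) m).
move=> n; rewrite mem_cat; apply/orP; case: (leqP m n) => mn.
  left; rewrite -(subnKC mn) word_val_mkseqD; apply: map_f; exact: wL.
by right; apply: map_f; rewrite mem_iota.
Qed.

Lemma not_finitely_valued w (k : nat -> nat) :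
  injective (fun i => word_val val (mkseq w (k i))) -> ~ finitely_valued w.
Proof.
move=> kI [L wL].
have uniq_val := map_inj_uniq kI (iota 0 (size L).+1).
rewrite iota_uniq in uniq_val; have := @uniq_leq_size _ _ L uniq_val.
by rewrite size_map size_iota ltnn => /(_ _)/notF; apply=> _ /mapP[i _ ->].
Qed.

End FinitelyValued.

(** * Energy conditions of an order and of its inverse *)

Section Chains.
Implicit Types (P : nat -> Prop) (R : nat -> nat -> Prop).

Lemma increasing_chain P R n0 :
    P n0 -> (forall n, P n -> exists2 m, (n < m)%N & P m /\ R n m) ->
    (forall m n p, R n m -> R m p -> R n p) ->
  exists2 k : nat -> nat, {homo k : i j / (i < j)%N} &
    forall i j, (i < j)%N -> R (k i) (k j).
Proof.
move=> P0 PS Rtr.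
have /choice[f fP] : forall n, exists m,
    P n -> [/\ (n < m)%N, P m & R n m].
  move=> n; case: (pselect (P n)) => [/PS[m nm [Pm Rnm]]|nP]; last by exists 0.
  by exists m.
have Pk i : P (iter i f n0) by elim: i => //= i /fP[].
exists (fun i => iter i f n0) => [|i j].
  by apply: homo_ltn => [? ? ?|i]; [apply: ltn_trans | case: (fP _ (Pk i))].
by apply: (homo_ltn Rtr) => {}i; case: (fP _ (Pk i)).
Qed.

End Chains.

Section EnergyUnion.
Variables (C : Type) (G : groupType) (le : rel G) (val : C -> G).
Hypothesis leG : totally_ordered_group le.
Local Open Scope group_scope.

Let lt x y := le x y && (x != y).

Lemma tog_lt_trans y x z : lt x y -> lt y z -> lt x z.
Proof.
case: leG => _ anti tr _ _ /andP[xy nxy] /andP[yz nyz].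
rewrite /lt (tr _ _ _ xy yz); apply: contraNneq nyz => xz.
by apply/eqP/anti; rewrite yz -xz.
Qed.

(** The positive powers of an element above 1 are at least that element, so
    they are not 1; an element below 1 has its inverse above 1. *)
Lemma tog_torsion_free (g : G) n : g ^+ n.+1 = 1 -> g = 1.
Proof.
case: leG => refl anti tr tot mon.
have pos h : le 1 h -> h ^+ n.+1 = 1 -> h = 1.
  move=> h1 hn; apply: anti; rewrite h1 andbT -hn.
  elim: n {hn} => [|m IHm]; first by rewrite expg1.
  apply: (tr _ _ _ IHm); have := mon _ _ 1 (h ^+ m.+1) h1.
  by rewrite !mul1g -expgS.
case/orP: (tot 1 g) => [|g1 gn]; first exact: pos.
apply: invg_inj; rewrite invg1; apply: pos; last by rewrite expVgn gn invg1.
by have := mon _ _ 1 g^-1 g1; rewrite !mul1g mulgV.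
Qed.

(** The union of the two conditions does not depend on the order: infinitely
    many values leave an injective subsequence, and an injective sequence in a
    total order has an infinite monotone subsequence. *)
Lemma energy_unionP w :
  (energy_condition le val `|` energy_condition (fun x y => le y x) val) w <->
  ~ finitely_valued val w.
Proof.
case: leG => refl anti tr tot mon.
pose v n := word_val val (mkseq w n.+1).
split.
  suff inj k : (forall i j, (i < j)%N -> v (k i) <> v (k j)) ->
      ~ finitely_valued val w.
    by case=> -[k _ kP]; apply: (inj k) => i j /kP/andP[_ /eqP] h e; apply: h.
  move=> kN; apply: (@not_finitely_valued _ _ _ _ (fun i => (k i).+1)) => i j e.
  by case: (ltngtP i j) => // /kN; rewrite /v e.
move=> winf.
have fresh n : exists2 m, (n < m)%N & forall i, (i <= n)%N -> v i != v m.
  apply: contrapT => h; apply: winf; exists (1 :: mkseq v n.+1) => -[|m].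
    by rewrite /word_val big_nil inE eqxx.
  rewrite inE; apply/orP; right; apply: contrapT => vm; apply: h; exists m.
    rewrite ltnNge; apply/negP => mn; apply: vm.
    by apply: (map_f v); rewrite mem_iota ltnS.
  move=> i iN; apply/eqP => vim; apply: vm; rewrite -/(v m) -vim.
  by apply: (map_f v); rewrite mem_iota ltnS.
have [k k_incr kI] : exists2 k : nat -> nat, {homo k : i j / (i < j)%N} &
    forall i j, (i < j)%N -> v (k i) != v (k j).
  have [|||k k_incr kP] := @increasing_chain (fun=> True)
      (fun n m => (n < m)%N /\ forall i, (i <= n)%N -> v i != v m) 0.
  - by [].
  - by move=> n _; have [m nm mP] := fresh n; exists m.
  - move=> m n p [nm _] [mp pP]; split; first exact: ltn_trans mp.
    by move=> i iN; apply: pP; rewrite (leq_trans iN) // ltnW.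
  by exists k => // i j /kP[_]; apply.
pose u i := v (k i).
have sub (l : nat -> nat) : {homo l : i j / (i < j)%N} ->
    {homo (k \o l) : i j / (i < j)%N} by move=> lh i j /lh/k_incr.
have [[N upN]|noN] := pselect (exists N, forall n, (N <= n)%N ->
    exists2 m, (n < m)%N & lt (u n) (u m)).
  right; have [|n Nn|m n p|l lh lP] := @increasing_chain (leq N)
      (fun n m => lt (u n) (u m)) N; first exact: leqnn.
  - have [m nm um] := upN n Nn; exists m => //; split=> //.
    exact: leq_trans (ltnW nm).
  - exact: tog_lt_trans.
  exists (k \o l); first exact: sub.
  by move=> i j /lP /andP[h1 h2] /=; rewrite h1 eq_sym.
(* Otherwise there are infinitely many peaks, i.e. positions whose value
   exceeds all later ones. *)
left; pose peak n := forall m, (n < m)%N -> lt (u m) (u n).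
have peaks N : exists2 n, (N <= n)%N & peak n.
  apply: contrapT => h; apply: noN; exists N => n Nn; apply: contrapT => h'.
  apply: h; exists n => // m nm; rewrite /lt eq_sym kI // andbT.
  case/orP: (tot (u n) (u m)) => // unm; case: h'; exists m => //.
  by rewrite /lt unm kI.
have [n0 _ p0] := peaks 0.
have [n pn|m n p nm mp|l lh lP] := @increasing_chain peak
    (fun n m => lt (u m) (u n)) n0 p0.
- by have [m nm pm] := peaks n.+1; exists m => //; split=> //; apply: pn.
- exact: tog_lt_trans mp nm.
by exists (k \o l); [exact: sub | exact: lP].
Qed.

End EnergyUnion.

(** * Graphs labelled by a torsion-free group *)

Section OnePlayer.
Variables (V E : finType) (src tgt : E -> V) (G : groupType) (val : E -> G).
Hypothesis out_edge : forall v, exists e, src e = v.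
Hypothesis torsion_free : forall (g : G) n, (g ^+ n.+1 = 1)%g -> g = 1%g.
Implicit Types (s v : V) (f : {ffun V -> E}).
Local Open Scope group_scope.

Notation finval := (finitely_valued val).

Definition is_path s (e : nat -> E) : Prop :=
  src (e 0) = s /\ forall n, tgt (e n) = src (e n.+1).

Definition positional f : bool := [forall v, src (f v) == v].

Definition run_node f s n : V := iter n (fun v => tgt (f v)) s.
Definition run f s n : E := f (run_node f s n).
Definition run_val f s n : G := word_val val (mkseq (run f s) n).

Lemma run_nodeD f s m n : run_node f s (m + n) = run_node f (run_node f s m) n.
Proof. by rewrite /run_node addnC iterD. Qed.

Lemma run_shift f s m :
  run f (run_node f s m) = (fun i => run f s (m + i)%N).
Proof. by apply: funext => i; rewrite /run run_nodeD. Qed.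

Lemma finitely_valued_run f s m :
  finval (run f (run_node f s m)) <-> finval (run f s).
Proof. by rewrite run_shift; apply: finitely_valued_shift. Qed.

Lemma run_valD f s m n :
  run_val f s (m + n) = run_val f s m * run_val f (run_node f s m) n.
Proof. by rewrite /run_val word_val_mkseqD run_shift. Qed.

Lemma expg_injective (g : G) : g <> 1 -> injective (fun n => g ^+ n).
Proof.
move=> g1 m n; wlog mn : m n / (m <= n)%N => [hwlog|].
  by case/orP: (leq_total m n) => h e; [|apply/esym]; apply: hwlog.
rewrite -(subnKC mn) expgnDr -{1}[g ^+ m]mulg1 => /mulgI/esym.
by case: (n - m)%N => [|d]; [rewrite addn0 | move/torsion_free].
Qed.

(** A run that returns to a node repeats this cycle forever, so it visits the
    multiples of a fixed value by all powers of the value of the cycle.  In a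
    torsion-free group these are infinitely many unless the cycle has
    value 1. *)
Lemma run_cycle f s m n : (m <= n)%N -> finval (run f s) ->
  run_node f s n = run_node f s m -> run_val f s n = run_val f s m.
Proof.
move=> mn fin; rewrite -(subnKC mn) run_valD run_nodeD.
set d := (n - m)%N; set t := run_node f s m => td.
apply: contrapT => val_ne; move/(finitely_valued_run f s m): fin; rewrite -/t.
have tdn i : run_node f t (i * d) = t.
  by elim: i => // i IHi; rewrite mulSn run_nodeD td.
apply: (@not_finitely_valued _ _ _ _ (muln^~ d)) => i j.
have pow k : run_val f t (k * d) = run_val f t d ^+ k.
  elim: k => [|k IHk]; first by rewrite mul0n /run_val /word_val big_nil.
  by rewrite mulSn run_valD td IHk expgS.
rewrite -!/(run_val _ _ _) !pow; apply: expg_injective => d1.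
by apply: val_ne; rewrite d1 mulg1.
Qed.

(** If every positional run from [s] is finitely valued, then the pairs of a
    node and a value met by these runs are finitely many.  They are closed
    under edges: at the first visit of a node, the strategy can be redirected
    along any edge without changing the past, and later visits have the same
    value. *)
Lemma positional_suffices s :
    (forall f, positional f -> finval (run f s)) ->
  forall e, is_path s e -> finval e.
Proof.
move=> fin e [e0 eS].
have reach n : exists f k, [/\ positional f, run_node f s k = src (e n)
    & run_val f s k = word_val val (mkseq e n)].
  elim: n => [|n [f [k0 [fpos k0n k0v]]]].
    have [g gP] := choice out_edge; exists (finfun g), 0; split=> //.
    by apply/forallP => v; rewrite ffunE gP.
  have kex : exists k, run_node f s k == src (e n) by exists k0; apply/eqP.
  case: (ex_minnP kex) => k /eqP kn kmin.
  have kv : run_val f s k = word_val val (mkseq e n).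
    rewrite -k0v; apply/esym/run_cycle; rewrite ?kn ?k0n //; last exact: fin.
    by apply: kmin; rewrite k0n.
  pose f' := [ffun v => if v == src (e n) then e n else f v].
  have past i : (i <= k)%N -> run_node f' s i = run_node f s i.
    elim: i => // i IHi ik; rewrite /run_node /= -/(run_node f s i).
    rewrite -/(run_node f' s i) IHi ?(ltnW ik) // ffunE.
    by case: eqP => // /eqP/kmin; rewrite leqNgt ik.
  have f'k : f' (run_node f' s k) = e n by rewrite past // kn ffunE eqxx.
  exists f', k.+1; split.
  - apply/forallP => v; rewrite ffunE; case: (v =P src (e n)) => [->//|_].
    exact: (forallP fpos).
  - by rewrite /run_node /= -/(run_node f' s k) f'k eS.
  rewrite /run_val !word_val_mkseqS /run f'k -kv; congr (word_val val _ * _).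
  apply/eq_in_map => i; rewrite mem_iota /= => ik.
  rewrite /run past ?(ltnW ik) // ffunE.
  by case: eqP => // /eqP/kmin; rewrite leqNgt ik.
have /choice[L LP] : forall f, exists L : seq G,
    positional f -> forall n, run_val f s n \in L.
  move=> f; case: (pselect (positional f)) => [/fin[L]|]; first by exists L.
  by exists [::].
exists (flatten [seq L f | f <- enum {ffun V -> E}]) => n.
have [f [k [fpos _ <-]]] := reach n.
apply/flatten_mapP; exists f; first by rewrite mem_enum.
exact: LP.
Qed.

(** A positional strategy with a largest set [W] of nodes whose runs have
    infinitely many values.  If another one did better at [s], then following
    the former inside [W] and the latter outside of [W] would enlarge [W], as
    finitely many initial moves do not matter. *)
Lemma uniform_positional :
  exists2 f, positional f &
    forall s, finval (run f s) -> forall e, is_path s e -> finval e.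
Proof.
pose win f := [set s | `[< ~ finval (run f s) >]]%SET.
have winP f s : reflect (~ finval (run f s)) (s \in win f).
  by rewrite inE; apply: asboolP.
have [g gP] := choice out_edge.
have g_pos : positional (finfun g) by apply/forallP => v; rewrite ffunE gP.
case: (@arg_maxnP _ (finfun g) positional (fun f => #|win f|) g_pos).
move=> f fpos fmax; exists f => // s fins.
apply: positional_suffices => f' f'pos.
apply: contrapT => f's.
pose h := [ffun v => if v \in win f then f v else f' v].
have hpos : positional h.
  apply/forallP => v; rewrite ffunE.
  by case: ifP => _; [exact: (forallP fpos) | exact: (forallP f'pos)].
have win_stable v n : v \in win f -> run_node f v n \in win f.
  by move=> /winP vW; apply/winP; rewrite finitely_valued_run.
have win_sub v : v \in win f -> v \in win h.
  move=> vW; have run_eq n : run_node h v n = run_node f v n.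
    elim: n => // n; rewrite /run_node /= => ->.
    by rewrite ffunE win_stable.
  apply/winP; rewrite (_ : run h v = run f v); first exact/winP.
  by apply: funext => n; rewrite /run run_eq ffunE win_stable.
have swin : s \in win h.
  have [[n nW]|noW] := pselect (exists n, run_node h s n \in win f).
    by apply/winP; rewrite -(finitely_valued_run h s n); apply/winP/win_sub.
  have out n : run_node h s n \in win f = false.
    by apply/negP => nW; apply: noW; exists n.
  have run_eq n : run_node h s n = run_node f' s n.
    elim: n => // n; have := out n; rewrite /run_node /= => outn <-.
    by rewrite ffunE outn.
  apply/winP; rewrite (_ : run h s = run f' s) //.
  by apply: funext => n; rewrite /run -run_eq ffunE out.
have := fmax h hpos; rewrite /= leqNgt => /negP; apply; apply: proper_card.
apply/properP; split; first exact/fintype.subsetP.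
by exists s => //; apply/winP.
Qed.

End OnePlayer.

(** * Arenas without nodes of Bob *)

Section NoBob.
Variable le : rel F2.
Hypothesis leF : totally_ordered_group le.

Lemma alice_positional_no_bob (A : arena color) : #|bob_node A| = 0 ->
  alice_positional A (energy_condition le color_val `|`
                      energy_condition (fun x y => le y x) color_val).
Proof.
move=> noB.
have out (v : node A) : exists e : edge A, source e = v.
  by have [c [t ct]] := edges_total v; exists (exist _ (v, c, t) ct).
have [f fpos fopt] := @uniform_positional (node A)
  {e : node A * color * node A | e \in edges A} (@source _ A) (@target _ A) F2
  (color_val \o @col _ A) out (tog_torsion_free leF).
have src_f v : source (f v) = v by apply/eqP/(forallP fpos).
have finE (e : nat -> edge A) : finitely_valued (color_val \o @col _ A) e <->
    finitely_valued color_val (fun n => col (e n)).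
  suff valE n : word_val (color_val \o @col _ A) (mkseq e n) =
      word_val color_val (mkseq (fun n => col (e n)) n).
    by split=> -[L LP]; exists L => n; have := LP n; rewrite valE.
  by rewrite /word_val /mkseq !big_map.
exists (fun u => f (inl u)) => [u|s nwin]; first exact: src_f.
exists (fun _ u => f (inr u)) => [h u|e eplay _]; first exact: src_f.
move=> /(energy_unionP _ leF) nfin; apply: nwin => e' [e'0 e'S] e'cons.
have e'f n : e' n = f (source (e' n)).
  case def_u: (source (e' n)) => [u|u]; first exact: e'cons.
  by have := card0_eq noB u; rewrite inE.
have srcE n : source (e' n) = run_node (@target _ A) f s n.
  by elim: n => // n IHn; rewrite -e'S e'f IHn.
have -> : (fun n => col (e' n)) = (fun n => col (run (@target _ A) f s n)).
  by apply: funext => n; rewrite e'f srcE.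
apply/(energy_unionP _ leF) => fin; apply: nfin.
by apply/finE; apply: (fopt s) => //; apply/finE.
Qed.

End NoBob.

(** * An arena where Alice needs memory *)

Section Switch.
Local Open Scope group_scope.

Implicit Types x s : bool.

Definition letter_val x s : F2 := if s then fg_gen x else (fg_gen x)^-1.

Lemma letter_val_in x s :
  letter_val x s \in [:: gen_a; gen_a^-1; gen_b; gen_b^-1; (1 : F2)].
Proof. by case: x s => -[]; rewrite !inE eqxx ?orbT. Qed.

Lemma one_in : (1 : F2) \in [:: gen_a; gen_a^-1; gen_b; gen_b^-1; 1].
Proof. by rewrite !inE eqxx !orbT. Qed.

Definition letter_color x s : color := SeqSub (letter_val_in x s).
Definition one_color : color := SeqSub one_in.

(** Alice selects a generator, then Bob selects this generator or its inverse
    and gives the move back to Alice. *)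
Definition switch_edges : {set (unit + bool) * color * (unit + bool)} :=
  [set e | match e with
           | (inl _, c, inr _) => c == one_color
           | (inr x, c, inl _) => [exists s, c == letter_color x s]
           | _ => false
           end]%SET.

Lemma switch_edges_total v : exists c t, (v, c, t) \in switch_edges.
Proof.
case: v => [u|x].
  by exists one_color, (inr true); rewrite inE.
exists (letter_color x true), (inl tt); rewrite inE.
by apply/existsP; exists true.
Qed.

Definition switch : arena color := Arena switch_edges_total.

Definition hub : node switch := inl tt.

Lemma alice_edgeP (e : edge switch) : source e = hub ->
  col e = one_color /\ exists x, target e = inr x.
Proof.
case: e => -[[v c] t] /= eS; rewrite /source /col /target /= => vh.
by move: eS; rewrite inE vh; case: t => // x /eqP ->; split=> //; exists x.
Qed.

Lemma bob_edgeP (e : edge switch) x : source e = inr x ->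
  target e = hub /\ exists s, col e = letter_color x s.
Proof.
case: e => -[[v c] t] /= eS; rewrite /source /col /target /= => vh.
by move: eS; rewrite inE vh; case: t => // -[] /existsP[s /eqP ->]; split=> //;
  exists s.
Qed.

Lemma alice_edge_ex x :
  exists2 e : edge switch, source e = hub & target e = inr x.
Proof.
have eS : (hub, one_color, inr x) \in edges switch by rewrite inE.
by exists (exist (fun e => e \in edges switch) _ eS).
Qed.

Lemma bob_edge_ex x s : exists2 e : edge switch,
  source e = inr x & target e = hub /\ col e = letter_color x s.
Proof.
have eS : (inr x, letter_color x s, hub) \in edges switch.
  by rewrite inE; apply/existsP; exists s.
by exists (exist (fun e => e \in edges switch) _ eS).
Qed.

(** Letters over different generators are never inverse to each other, so
    nothing cancels in this product. *)
Lemma alternating_word (s : nat -> bool) n :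
  fg_word (\prod_(i <- iota 0 n) letter_val (odd i) (s i)) =
  mkseq (fun i => (odd i, s i)) n.
Proof.
have red : reduced (mkseq (fun i => (odd i, s i)) n).
  apply/(sortedP (true, true)) => i; rewrite size_mkseq => iN.
  by rewrite !nth_mkseq ?(ltnW iN) //= xpair_eqE; case: (odd i).
have := congr1 (@fg_word _) (fg_gen_decomp (FreeGroup red)).
by rewrite /= big_map => <-.
Qed.

(** Alternating between the two generators wins for Alice: after [2 * n] moves
    the value is a reduced word of length [n], whatever Bob does. *)
Lemma alternating_infinite (w : nat -> color) :
    (forall n, w n.*2 = one_color) ->
    (forall n, exists s, w n.*2.+1 = letter_color (odd n) s) ->
  ~ finitely_valued color_val w.
Proof.
move=> w_even /choice[s w_odd].
have valE n : word_val color_val (mkseq w n.*2) =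
    \prod_(i <- iota 0 n) letter_val (odd i) (s i).
  elim: n => [|n IHn]; first by rewrite /word_val !big_nil.
  rewrite doubleS !word_val_mkseqS IHn w_even w_odd -addn1 iotaD big_cat.
  by rewrite big_seq1 /= mulg1.
apply: (@not_finitely_valued _ _ _ _ double) => m n; rewrite !valE.
move=> /(congr1 (size \o @fg_word _)).
by rewrite /= !alternating_word !size_mkseq.
Qed.

(** When Alice always selects the same generator [x], Bob can alternate
    between [x] and its inverse, which keeps the value in [{1, x}]. *)
Lemma constant_finite (w : nat -> color) x :
    (forall n, w n.*2 = one_color) ->
    (forall n, w n.*2.+1 = letter_color x (~~ odd n)) ->
  finitely_valued color_val w.
Proof.
move=> w_even w_odd; exists [:: 1; fg_gen x] => n.
suff -> : word_val color_val (mkseq w n) = if odd n./2 then fg_gen x else 1.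
  by case: ifP; rewrite !inE eqxx ?orbT.
elim: n => [|n IHn]; first by rewrite /word_val big_nil.
rewrite word_val_mkseqS IHn -{2}(odd_double_half n) /= uphalf_half.
case: (odd n); rewrite ?add1n ?add0n ?w_odd ?w_even /=; last by rewrite mulg1.
by rewrite /color_val /= /letter_val; case: (odd n./2); rewrite /= ?mulgV ?mul1g.
Qed.

(** The play against [tau] where Alice goes to [inr (odd n)] at her [n]-th
    turn. *)
Lemma alternating_play (tau : strategy switch Bob) : is_strategy tau ->
  exists2 e : nat -> edge switch, is_play hub e /\ consistent tau e &
    ~ finitely_valued color_val (fun n => col (e n)).
Proof.
move=> tauP.
have /choice[a aP] : forall x, exists a : edge switch,
    source a = hub /\ target a = inr x.
  by move=> x; have [a] := alice_edge_ex x; exists a.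
pose next n h := if odd n then tau h (odd n./2) else a (odd n./2).
pose hist := fix hist n := if n is m.+1 then rcons (hist m) (next m (hist m))
                           else [::].
pose e n := next n (hist n).
have histE n : hist n = mkseq e n.
  by elim: n => // n IHn; rewrite mkseqS -IHn.
have e_even n : e n.*2 = a (odd n) by rewrite /e /next odd_double doubleK.
have e_odd n : e n.*2.+1 = tau (mkseq e n.*2.+1) (odd n).
  by rewrite -histE /e /next /= odd_double /= uphalf_double.
have src_odd n : source (e n.*2.+1) = inr (odd n).
  by rewrite e_odd; exact: (tauP).
have src_even n : source (e n.*2) = hub by rewrite e_even; case: (aP (odd n)).
exists e; last first.
  apply: alternating_infinite => n; first by case: (alice_edgeP (src_even n)).
  by case: (bob_edgeP (src_odd n)).
split; first split; first by have := src_even 0.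
  move=> n; rewrite -(odd_double_half n); case: (odd n); rewrite ?add1n ?add0n.
    by rewrite -doubleS src_even; case: (bob_edgeP (src_odd n./2)).
  by rewrite src_odd e_even; case: (aP (odd n./2)).
move=> n u; rewrite -(odd_double_half n); case: (odd n); rewrite ?add1n ?add0n.
  by rewrite src_odd e_odd => -[->].
by rewrite src_even.
Qed.

Lemma constant_play (sigma : alice_node switch -> edge switch) :
  is_positional sigma ->
  exists2 e : nat -> edge switch,
    is_play hub e /\ consistent (positional_strategy sigma) e &
    finitely_valued color_val (fun n => col (e n)).
Proof.
move=> sP; have [scol [x sT]] := alice_edgeP (sP tt).
have /choice[b bP] : forall s, exists b : edge switch,
    [/\ source b = inr x, target b = hub & col b = letter_color x s].
  by move=> s; have [b ? []] := bob_edge_ex x s; exists b.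
pose e n := if odd n then b (~~ odd n./2) else sigma tt.
have e_even n : e n.*2 = sigma tt by rewrite /e odd_double.
have e_odd n : e n.*2.+1 = b (~~ odd n).
  by rewrite /e /= odd_double /= uphalf_double.
exists e; last first.
  apply: (@constant_finite _ x) => n; first by rewrite e_even.
  by rewrite e_odd; case: (bP (~~ odd n)).
split; first split; first exact: sP.
  move=> n; rewrite -(odd_double_half n); case: (odd n); rewrite ?add1n ?add0n.
    by rewrite -doubleS e_even e_odd sP; case: (bP (~~ odd n./2)).
  by rewrite e_even e_odd sT; case: (bP (~~ odd n./2)).
move=> n []; rewrite -(odd_double_half n); case: (odd n); rewrite ?add1n ?add0n.
  by rewrite e_odd; case: (bP (~~ odd n./2)) => ->.
by rewrite e_even.
Qed.

End Switch.

Lemma not_half_positional_energy_union (le : rel F2) :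
  totally_ordered_group le ->
  ~ half_positional (energy_condition le color_val `|`
                     energy_condition (fun x y => le y x) color_val).
Proof.
move=> leF /(_ switch)[sigma sP /(_ hub) optimal].
have [|tau tauP tau_win] := optimal.
  have [e [eplay econs] efin] := constant_play sP.
  by move=> /(_ e eplay econs)/(energy_unionP _ leF); apply.
have [e [eplay econs] einf] := alternating_play tauP.
by apply: (tau_win e eplay econs); apply/energy_unionP.
Qed.

Unset Implicit Arguments.

Theorem mainTheorem4 (le : rel F2) (hle : totally_ordered_group le) :
  let W1 : set (nat -> color) := energy_condition le color_val in
  let W2 : set (nat -> color) :=
    energy_condition (fun x y => le y x) color_val in
  (forall A : arena color, #|bob_node A| = 0 ->
     alice_positional A (W1 `|` W2)) /\
  ~ half_positional (W1 `|` W2).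
Proof.
split; last exact: not_half_positional_energy_union.
exact: alice_positional_no_bob.
Qed.
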